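(* Let $\underline{C}$ be a triangulated category endowed with a weight structure $w$, let $m\le n$ be integers, and let $g\in \underline{C}(M,N)$ be a morphism of $\underline{C}$. Then the following conditions are equivalent. 1. $g$ kills weights $m,\dots,n$. 2. For any abelian category $\underline{A}$ and any contravariant functor $H:\underline{C}\to\underline{A}$, the morphism $H(g):H(N)\to H(M)$ sends $W^{m}(H)(N)$ inside $W^{n+1}(H)(M)$. 3. $H_I(g)$ sends $W^{m}(H_I)(N)$ inside $W^{n+1}(H_I)(M)$ for all $I\in \underline{C}_{w\ge m}$. 4. $H(g)=0$ whenever $H$ is a cohomological functor from $\underline{C}$ into an abelian category $\underline{A}$ (both $H$ and $\underline{A}$ arbitrary) that is of weight range $[m,n]$. 5. $H(g)=0$ for $H=\tau_{\le n}(H_I)$ whenever $I\in\underline{C}_{w\ge m}$. 6. $H(g)=0$, where $H=\tau_{\le n}(H_{I_0})$ and $I_0$ is some fixed choice of $w_{\ge m}N$.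
   Context: Notation: $\underline{C}(X,Y)$ is the set of morphisms from $X$ to $Y$; for $I\in\operatorname{Obj}\underline{C}$, $H_I=\underline{C}(-,I)$. For classes $D,E$ of objects, $D^{\perp}=\{Y:\underline{C}(X,Y)=0\ \forall X\in D\}$ and ${}^{\perp}E=\{X:\underline{C}(X,Y)=0\ \forall Y\in E\}$. Torsion theory: a couple $s=(\mathcal{LO},\mathcal{RO})$ of classes of objects of $\underline{C}$ with $\mathcal{LO}^{\perp}=\mathcal{RO}$, $\mathcal{LO}={}^{\perp}\mathcal{RO}$, and such that every object $M$ fits in a distinguished triangle $L_sM\to M\to R_sM\to L_sM[1]$ with $L_sM\in\mathcal{LO}$, $R_sM\in\mathcal{RO}$. Weight structure: if $\mathcal{LO}\subset\mathcal{LO}[1]$ for a torsion theory $(\mathcal{LO},\mathcal{RO})$, the couple $w=(\underline{C}_{w\le 0},\underline{C}_{w\ge 0})=(\mathcal{LO},\mathcal{RO}[-1])$ is called a weight structure. Set $\underline{C}_{w\le k}=\underline{C}_{w\le 0}[k]$ and $\underline{C}_{w\ge k}=\underline{C}_{w\ge 0}[k]$ for $k\in\mathbb{Z}$. Weight decompositions: for $k\in\mathbb{Z}$, a $k$-weight decomposition of $X$ is a distinguished triangle $w_{\le k}X\to X\to w_{\ge k+1}X\to (w_{\le k}X)[1]$ with $w_{\le k}X\in\underline{C}_{w\le k}$ and $w_{\ge k+1}X\in\underline{C}_{w\ge k+1}$. It always exists but is not canonical; ''a choice of $w_{\le k}X$ or $w_{\ge k+1}X$'' always comes from some such triangle, together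 with its connecting morphisms. Any $g\in \underline{C}(X,Y)$ extends to a morphism from a given $k$-weight decomposition of $X$ to a given $l$-weight decomposition of $Y$ whenever $k\le l$; the extension is unique if $k<l$. Killing weights: $g\in\underline{C}(M,N)$ kills weights $m,\dots,n$ if for some (equivalently, for any) choice of $w_{\le n}M$ and $w_{\ge m}N$ the composition $w_{\le n}M\to M\stackrel{g}{\to}N\to w_{\ge m}N$ is zero; equivalently, for some (equivalently, any) choice of $w_{\le n}M$ and $w_{\le m-1}N$ there is a morphism $h:w_{\le n}M\to w_{\le m-1}N$ making the square with $g$ and the connecting morphisms $w_{\le n}M\to M$, $w_{\le m-1}N\to N$ commutative. Weight filtration: for a contravariant functor $H$ from $\underline{C}$ into an abelian category, $W^k(H)(X)=\operatorname{Im}(H(w_{\ge k}X)\to H(X))$; this does not depend on choices and is functorial in $X$. Virtual $t$-truncation: $\tau_{\le k}(H)(X)=\operatorname{Im}(H(w_{\le k+1}X)\to H(w_{\le k}X))$, where $w_{\le k}X\to w_{\le k+1}X$ is the unique morphism compatible with the morphisms of these objects to $X$, that is, the first component of the unique morphism from the chosen $k$-weight decomposition of $X$ to the chosen $(k+1)$-weight decomposition of $X$ that extends $\operatorname{id}_X$. This is (essentially independently of choices) a contravariant functor in $X$; the action on a morphism $g:X\to Y$ is induced by extending $g$ to morphisms $w_{\le k}X\to w_{\le k}Y$ and $w_{\le k+1}X\to w_{\le k+1}Y$ of weight decompositions. A contravariant functor into an abelian category is cohomological if it converts distinguished triangles into long exact sequences. A cohomological functor $H$ is of weight range $[m,n]$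 if it annihilates both $\underline{C}_{w\le m-1}$ and $\underline{C}_{w\ge n+1}$. *)

(* Defs.v *)
From HB Require Import structures.
From mathcomp Require Import all_boot all_order all_algebra.
From mathcomp Require Import generic_quotient ring_quotient.
From mathcomp Require Import boolp.

Set Implicit Arguments.
Unset Strict Implicit.
Unset Printing Implicit Defensive.

Import Order.TTheory GRing.Theory Num.Theory.
Local Open Scope ring_scope.

Record preadditive := Preadditive {
  obj :> Type;
  Mor : obj -> obj -> zmodType;
  idmor : forall X, Mor X X;
  compm : forall X Y Z, Mor Y Z -> Mor X Y -> Mor X Z;
  compA : forall X Y Z W (h : Mor Z W) (g : Mor Y Z) (f : Mor X Y),
    compm h (compm g f) = compm (compm h g) f;
  comp1m : forall X Y (f : Mor X Y), compm (idmor Y) f = f;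
  compm1 : forall X Y (f : Mor X Y), compm f (idmor X) = f;
  compDl : forall X Y Z (g g' : Mor Y Z) (f : Mor X Y),
    compm (g + g') f = compm g f + compm g' f;
  compDr : forall X Y Z (g : Mor Y Z) (f f' : Mor X Y),
    compm g (f + f') = compm g f + compm g f'
}.
Arguments idmor {p} X.
Arguments Mor {p} X Y.

Notation "g \oc f" := (compm g f) (at level 40, left associativity) : ring_scope.

Section PreadditiveDefs.
Variable C : preadditive.
Implicit Types X Y Z K : C.

Definition inverses X Y (f : Mor X Y) (g : Mor Y X) : Prop :=
  g \oc f = idmor X /\ f \oc g = idmor Y.

Definition is_iso X Y (f : Mor X Y) : Prop := exists g, inverses f g.

Definition isomorphic X Y : Prop := exists f : Mor X Y, is_iso f.

Definition is_zero Z : Prop :=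
  (forall X (f : Mor X Z), f = 0) /\ (forall X (f : Mor Z X), f = 0).

Definition is_biproduct X Y B
    (i1 : Mor X B) (i2 : Mor Y B) (p1 : Mor B X) (p2 : Mor B Y) : Prop :=
  [/\ p1 \oc i1 = idmor X, p2 \oc i2 = idmor Y, p1 \oc i2 = 0, p2 \oc i1 = 0
    & i1 \oc p1 + i2 \oc p2 = idmor B].

Definition is_additive : Prop :=
  (exists Z, is_zero Z) /\
  (forall X Y, exists B (i1 : Mor X B) (i2 : Mor Y B) (p1 : Mor B X)
     (p2 : Mor B Y), is_biproduct i1 i2 p1 p2).

Definition mono X Y (f : Mor X Y) : Prop :=
  forall W (a b : Mor W X), f \oc a = f \oc b -> a = b.

Definition epi X Y (f : Mor X Y) : Prop :=
  forall W (a b : Mor Y W), a \oc f = b \oc f -> a = b.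

Definition is_kernel X Y K (f : Mor X Y) (i : Mor K X) : Prop :=
  f \oc i = 0 /\
  forall W (j : Mor W X), f \oc j = 0 -> exists! s : Mor W K, i \oc s = j.

Definition is_cokernel X Y Q (f : Mor X Y) (p : Mor Y Q) : Prop :=
  p \oc f = 0 /\
  forall W (q : Mor Y W), q \oc f = 0 -> exists! s : Mor Q W, s \oc p = q.

End PreadditiveDefs.

(* Kernels and cokernels are chosen; by the axiom of choice this is no loss of
   generality. *)
Record abelian_cat := AbelianCat {
  ab_cat :> preadditive;
  ab_additive : is_additive ab_cat;
  kerO : forall X Y : ab_cat, Mor X Y -> ab_cat;
  kerM : forall (X Y : ab_cat) (f : Mor X Y), Mor (kerO f) X;
  kerP : forall (X Y : ab_cat) (f : Mor X Y), is_kernel f (kerM f);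
  cokerO : forall X Y : ab_cat, Mor X Y -> ab_cat;
  cokerM : forall (X Y : ab_cat) (f : Mor X Y), Mor Y (cokerO f);
  cokerP : forall (X Y : ab_cat) (f : Mor X Y), is_cokernel f (cokerM f);
  mono_normal : forall (X Y : ab_cat) (f : Mor X Y), mono f ->
    exists (Z : ab_cat) (g : Mor Y Z), is_kernel g f;
  epi_normal : forall (X Y : ab_cat) (f : Mor X Y), epi f ->
    exists (W : ab_cat) (g : Mor W X), is_cokernel g f
}.
Arguments kerO {a X Y} f.
Arguments kerM {a X Y} f.
Arguments cokerO {a X Y} f.
Arguments cokerM {a X Y} f.

Section Image.
Variable A : abelian_cat.
Implicit Types X Y Z : A.

Definition imO X Y (f : Mor X Y) : A := kerO (cokerM f).
Definition imM X Y (f : Mor X Y) : Mor (imO f) Y := kerM (cokerM f).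

(* [Im f = Ker g] as subobjects of [Y]. *)
Definition exact_at X Y Z (f : Mor X Y) (g : Mor Y Z) : Prop :=
  is_kernel g (imM f).

(* [u] sends the subobject [i] of [X] inside the subobject [j] of [Y]. *)
Definition sends_inside X Y S T (u : Mor X Y) (i : Mor S X) (j : Mor T Y) :
  Prop := exists s : Mor S T, u \oc i = j \oc s.

End Image.

Record contrafunctor (C D : preadditive) := ContraFunctor {
  cobj :> C -> D;
  cmap : forall X Y : C, Mor X Y -> Mor (cobj Y) (cobj X);
  cmap1 : forall X : C, cmap (idmor X) = idmor (cobj X);
  cmapM : forall (X Y Z : C) (g : Mor Y Z) (f : Mor X Y),
    cmap (g \oc f) = cmap f \oc cmap g
}.

Record additive_functor (C D : preadditive) := AdditiveFunctor {
  fobj :> C -> D;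
  fmap : forall X Y : C, Mor X Y -> Mor (fobj X) (fobj Y);
  fmap1 : forall X : C, fmap (idmor X) = idmor (fobj X);
  fmapM : forall (X Y Z : C) (g : Mor Y Z) (f : Mor X Y),
    fmap (g \oc f) = fmap g \oc fmap f;
  fmapD : forall (X Y : C) (f g : Mor X Y), fmap (f + g) = fmap f + fmap g
}.

(* The shift is an autoequivalence with a chosen quasi-inverse: [sh_unit] and
   [sh_counit] make the two functors an adjoint equivalence, which is no loss
   of generality.  A strictly invertible shift is the case where they are
   identities. *)
Record shift_cat := ShiftCat {
  sc_cat :> preadditive;
  sc_additive : is_additive sc_cat;
  sh : additive_functor sc_cat sc_cat;
  unsh : additive_functor sc_cat sc_cat;
  sh_unit : forall X : sc_cat, Mor X (unsh (sh X));
  sh_unitV : forall X : sc_cat, Mor (unsh (sh X)) X;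
  sh_unitP : forall X : sc_cat, inverses (sh_unit X) (sh_unitV X);
  sh_unit_nat : forall (X Y : sc_cat) (f : Mor X Y),
    fmap unsh (fmap sh f) \oc sh_unit X = sh_unit Y \oc f;
  sh_counit : forall X : sc_cat, Mor (sh (unsh X)) X;
  sh_counitV : forall X : sc_cat, Mor X (sh (unsh X));
  sh_counitP : forall X : sc_cat, inverses (sh_counit X) (sh_counitV X);
  sh_counit_nat : forall (X Y : sc_cat) (f : Mor X Y),
    f \oc sh_counit X = sh_counit Y \oc fmap sh (fmap unsh f);
  sh_triangle : forall X : sc_cat,
    sh_counit (sh X) \oc fmap sh (sh_unit X) = idmor (sh X)
}.
Arguments sh {s}.
Arguments unsh {s}.

Record triangle (C : shift_cat) := Triangle {
  tX : C; tY : C; tZ : C;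
  tf : Mor tX tY;
  tg : Mor tY tZ;
  th : Mor tZ (sh tX)
}.

Definition triangle_iso (C : shift_cat) (s t : triangle C) : Prop :=
  exists (a : Mor (tX s) (tX t)) (b : Mor (tY s) (tY t))
         (c : Mor (tZ s) (tZ t)),
    [/\ is_iso a, is_iso b & is_iso c] /\
    [/\ b \oc tf s = tf t \oc a, c \oc tg s = tg t \oc b
      & fmap sh a \oc th s = th t \oc c].

Definition trot (C : shift_cat) (t : triangle C) : triangle C :=
  Triangle (tg t) (th t) (- fmap sh (tf t)).

Definition tunrot (C : shift_cat) (t : triangle C) : triangle C :=
  Triangle (- (sh_unitV (tX t) \oc fmap unsh (th t))) (tf t)
           (sh_counitV (tZ t) \oc tg t).

Record triangulated_cat := TriangulatedCat {
  tr_cat :> shift_cat;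
  dist : triangle tr_cat -> Prop;
  dist_iso : forall s t, triangle_iso s t -> dist s -> dist t;
  dist_id : forall X Z : tr_cat, is_zero Z ->
    dist (Triangle (idmor X) (0 : Mor X Z) (0 : Mor Z (sh X)));
  dist_ext : forall (X Y : tr_cat) (f : Mor X Y),
    exists (Z : tr_cat) (g : Mor Y Z) (h : Mor Z (sh X)),
      dist (Triangle f g h);
  dist_rot : forall t, dist t <-> dist (trot t);
  dist_mor : forall s t, dist s -> dist t ->
    forall (a : Mor (tX s) (tX t)) (b : Mor (tY s) (tY t)),
    b \oc tf s = tf t \oc a ->
    exists c : Mor (tZ s) (tZ t),
      c \oc tg s = tg t \oc b /\ fmap sh a \oc th s = th t \oc c;
  dist_octa : forall (X Y Z X' Y' Z' : tr_cat)
      (f : Mor X Y) (f' : Mor Y Z') (f'' : Mor Z' (sh X))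
      (g : Mor Y Z) (g' : Mor Z X') (g'' : Mor X' (sh Y))
      (h' : Mor Z Y') (h'' : Mor Y' (sh X)),
    dist (Triangle f f' f'') -> dist (Triangle g g' g'') ->
    dist (Triangle (g \oc f) h' h'') ->
    exists (u : Mor Z' Y') (v : Mor Y' X'),
      [/\ dist (Triangle u v (fmap sh f' \oc g'')),
          u \oc f' = h' \oc g, h'' \oc u = f'',
          v \oc h' = g' & g'' \oc v = fmap sh f \oc h'']
}.
Arguments dist {t0} _.

(* Consecutive maps of the long sequence of [t] are the first two maps of its
   iterated rotations, in both directions. *)
Definition cohomological (C : triangulated_cat) (A : abelian_cat)
    (H : contrafunctor C A) : Prop :=
  forall t : triangle C, dist t -> forall (n : nat) (r : triangle C),
    r = iter n (@trot C) t \/ r = iter n (@tunrot C) t ->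
    exact_at (cmap H (tg r)) (cmap H (tf r)).

Section Classes.
Variable C : triangulated_cat.
Implicit Types (X Y M : C) (D E : C -> Prop).

Definition shz (k : int) (X : C) : C :=
  match k with
  | Posz n => iter n sh X
  | Negz n => iter n.+1 unsh X
  end.

(* [D[k]], closed under isomorphism since the shift is only an equivalence. *)
Definition cshift D (k : int) : C -> Prop :=
  fun M => exists2 X, D X & isomorphic M (shz k X).

Definition rperp D : C -> Prop :=
  fun Y => forall X, D X -> forall f : Mor X Y, f = 0.

Definition lperp E : C -> Prop :=
  fun X => forall Y, E Y -> forall f : Mor X Y, f = 0.

Definition torsion_theory (LO RO : C -> Prop) : Prop :=
  [/\ (forall Y, rperp LO Y <-> RO Y),
      (forall X, LO X <-> lperp RO X)
    & forall M, exists (L R : C) (a : Mor L M) (b : Mor M R)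
        (c : Mor R (sh L)), [/\ dist (Triangle a b c), LO L & RO R]].

End Classes.

Record weight_structure (C : triangulated_cat) := WeightStructure {
  wLO : C -> Prop;
  wRO : C -> Prop;
  w_torsion : torsion_theory wLO wRO;
  w_shift : forall X, wLO X -> cshift wLO 1 X
}.

Section Weights.
Variables (C : triangulated_cat) (w : weight_structure C).

Definition w_le (k : int) : C -> Prop := cshift (wLO w) k.
Definition w_ge (k : int) : C -> Prop := cshift (cshift (wRO w) (-1)) k.

Record wdecomp (k : int) (X : C) := WDecomp {
  wle : C;
  wge : C;
  wleM : Mor wle X;
  wgeM : Mor X wge;
  wdM : Mor wge (sh wle);
  wd_dist : dist (Triangle wleM wgeM wdM);
  wleP : w_le k wle;
  wgeP : w_ge (k + 1) wge
}.

(* A choice of all weight decompositions; one exists by [wchoice_exists]. *)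
Definition wchoice := forall (k : int) (X : C), wdecomp k X.

Definition kills_weights (m n : int) (M N : C) (g : Mor M N) : Prop :=
  exists (D : wdecomp n M) (E : wdecomp (m - 1) N),
    wgeM E \oc g \oc wleM D = 0.

Definition weight_range (A : abelian_cat) (H : contrafunctor C A)
    (m n : int) : Prop :=
  (forall X, w_le (m - 1) X -> is_zero (H X)) /\
  (forall X, w_ge (n + 1) X -> is_zero (H X)).

(* The subobject [W^k(H)(X)] of [H X]; [w_{>= k} X] is taken from a
   [(k - 1)]-weight decomposition of [X]. *)
Definition wfiltM (d : wchoice) (A : abelian_cat) (H : contrafunctor C A)
    (k : int) (X : C) : Mor (imO (cmap H (wgeM (d (k - 1) X)))) (H X) :=
  imM (cmap H (wgeM (d (k - 1) X))).

(* [a] is the first component of an extension of [g] to a morphism of weight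
   decompositions; the third one then exists by [dist_mor]. *)
Definition wext (k l : int) (X Y : C) (D : wdecomp k X) (E : wdecomp l Y)
    (g : Mor X Y) (a : Mor (wle D) (wle E)) : Prop :=
  wleM E \oc a = g \oc wleM D.

End Weights.

Section Basics.
Variable C : preadditive.
Implicit Types X Y Z : C.

Lemma comp0m X Y Z (f : Mor X Y) : (0 : Mor Y Z) \oc f = 0.
Proof. by apply: (addrI ((0 : Mor Y Z) \oc f)); rewrite -compDl !addr0. Qed.

Lemma compm0 X Y Z (g : Mor Y Z) : g \oc (0 : Mor X Y) = 0.
Proof. by apply: (addrI (g \oc (0 : Mor X Y))); rewrite -compDr !addr0. Qed.

Lemma compNm X Y Z (g : Mor Y Z) (f : Mor X Y) : (- g) \oc f = - (g \oc f).
Proof. by apply: (addrI (g \oc f)); rewrite -compDl !subrr comp0m. Qed.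

Lemma compmN X Y Z (g : Mor Y Z) (f : Mor X Y) : g \oc (- f) = - (g \oc f).
Proof. by apply: (addrI (g \oc f)); rewrite -compDr !subrr compm0. Qed.

Lemma compBm X Y Z (g g' : Mor Y Z) (f : Mor X Y) :
  (g - g') \oc f = g \oc f - g' \oc f.
Proof. by rewrite compDl compNm. Qed.

Lemma compmB X Y Z (g : Mor Y Z) (f f' : Mor X Y) :
  g \oc (f - f') = g \oc f - g \oc f'.
Proof. by rewrite compDr compmN. Qed.

Lemma inverses_sym X Y (f : Mor X Y) g : inverses f g -> inverses g f.
Proof. by case. Qed.

Lemma is_iso_id X : is_iso (idmor X).
Proof. by exists (idmor X); split; rewrite comp1m. Qed.

Lemma isom_refl X : isomorphic X X.
Proof. by exists (idmor X); apply: is_iso_id. Qed.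

Lemma isom_sym X Y : isomorphic X Y -> isomorphic Y X.
Proof. by case=> f [g /inverses_sym fg]; exists g, f. Qed.

Lemma isom_trans X Y Z : isomorphic X Y -> isomorphic Y Z -> isomorphic X Z.
Proof.
move=> [f [f' [f'f ff']]] [g [g' [g'g gg']]]; exists (g \oc f), (f' \oc g').
split; first by rewrite compA -(compA _ g') g'g compm1.
by rewrite compA -(compA _ f) ff' compm1.
Qed.

Definition orth X Y : Prop := forall f : Mor X Y, f = 0.

Lemma orth_iso X X' Y Y' :
  isomorphic X X' -> isomorphic Y Y' -> orth X Y -> orth X' Y'.
Proof.
move=> [a [a' [_ aa']]] [b [b' [_ bb']]] XY f.
rewrite -[f]compm1 -aa' -[f]comp1m -bb' -!compA (compA f) (compA b').
by rewrite (XY (b' \oc (f \oc a))) comp0m compm0.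
Qed.

End Basics.

Section Functors.
Variables (C D : preadditive) (F : additive_functor C D).

Lemma fmap0 (X Y : C) : fmap F (0 : Mor X Y) = 0.
Proof. by apply: (addrI (fmap F 0)); rewrite -fmapD !addr0. Qed.

Lemma fmapN (X Y : C) (f : Mor X Y) : fmap F (- f) = - fmap F f.
Proof. by apply: (addrI (fmap F f)); rewrite -fmapD !subrr fmap0. Qed.

Lemma fmap_iso (X Y : C) : isomorphic X Y -> isomorphic (F X) (F Y).
Proof.
move=> [f [g [gf fg]]]; exists (fmap F f), (fmap F g).
by split; rewrite -fmapM ?gf ?fg fmap1.
Qed.

End Functors.

Section ShiftFacts.
Variable C : triangulated_cat.
Implicit Types X Y Z L R M : C.

Lemma isom_unit X : isomorphic X (unsh (sh X)).
Proof. by exists (sh_unit X), (sh_unitV X); apply: sh_unitP. Qed.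

Lemma isom_counit X : isomorphic (sh (unsh X)) X.
Proof. by exists (sh_counit X), (sh_counitV X); apply: sh_counitP. Qed.

Lemma sh_inj X Y : injective (fmap (@sh C) (X := X) (Y := Y)).
Proof.
move=> f f' E; have [uV _] := sh_unitP Y.
rewrite -[f]comp1m -[f']comp1m -uV -!compA; congr (_ \oc _).
by rewrite -!sh_unit_nat E.
Qed.

Lemma unsh_inj X Y : injective (fmap (@unsh C) (X := X) (Y := Y)).
Proof.
move=> f f' E; have [_ cV] := sh_counitP X.
rewrite -[f]compm1 -[f']compm1 -cV !compA; congr (_ \oc _).
by rewrite !sh_counit_nat E.
Qed.

Lemma sh_full X Y (u : Mor (sh X) (sh Y)) : exists s : Mor X Y, u = fmap sh s.
Proof.
have [uVX uXV] := sh_unitP X; have [uVY uYV] := sh_unitP Y.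
exists (sh_unitV Y \oc fmap unsh u \oc sh_unit X).
apply: unsh_inj; rewrite -[LHS]compm1 -[RHS]compm1 -uXV !compA.
congr (_ \oc _); rewrite sh_unit_nat.
by rewrite !compA uYV comp1m.
Qed.

Lemma orth_sh X Y : orth X Y -> orth (sh X) (sh Y).
Proof.
move=> o f; apply: unsh_inj; rewrite fmap0.
by apply: (orth_iso (isom_unit X) (isom_unit Y) o).
Qed.

Lemma orth_unsh X Y : orth X Y -> orth (unsh X) (unsh Y).
Proof.
move=> o f; apply: sh_inj; rewrite fmap0.
by apply: (orth_iso (isom_sym (isom_counit X)) (isom_sym (isom_counit Y)) o).
Qed.

Lemma orth_shz k X Y : orth X Y -> orth (shz k X) (shz k Y).
Proof.
case: k => n o /=.
  by elim: n => // n IH; apply: orth_sh.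
by elim: n => [|n IH]; apply: orth_unsh.
Qed.

Lemma shz_iso k X Y : isomorphic X Y -> isomorphic (shz k X) (shz k Y).
Proof.
case: k => n i /=.
  by elim: n => // n IH; apply: fmap_iso.
by elim: n => [|n IH]; apply: fmap_iso.
Qed.

Lemma shzS k X : isomorphic (sh (shz k X)) (shz (k + 1) X).
Proof.
case: k => [n|[|n]].
- by rewrite -PoszD addn1; apply: isom_refl.
- exact: isom_counit.
- have -> : Negz n.+1 + 1 = Negz n.
    by rewrite !NegzE -(addn1 n.+1) PoszD opprD addrNK.
  exact: isom_counit.
Qed.

Lemma shz_sh k X : isomorphic (shz k (sh X)) (sh (shz k X)).
Proof.
case: k => n /=.
  by rewrite -iterSr; apply: isom_refl.
elim: n => [|n IH].
  exact: isom_trans (isom_sym (isom_unit X)) (isom_sym (isom_counit X)).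
apply: (isom_trans (fmap_iso unsh IH)).
exact: isom_trans (isom_sym (isom_unit _)) (isom_sym (isom_counit _)).
Qed.

Lemma iter_shK n X : isomorphic (iter n sh (iter n unsh X)) X.
Proof.
elim: n => [|n IH]; first exact: isom_refl.
rewrite iterSr iterS; apply: (isom_trans _ IH).
exact: (shz_iso (Posz n) (isom_counit _)).
Qed.

Lemma iter_unshK n X : isomorphic (iter n unsh (iter n sh X)) X.
Proof.
elim: n => [|n IH]; first exact: isom_refl.
rewrite iterSr iterS; apply: (isom_trans _ IH).
by case: n {IH} => [|n]; [|apply: (shz_iso (Negz n))]; apply: isom_sym (isom_unit _).
Qed.

Lemma shzK k X : isomorphic (shz k (shz (- k) X)) X.
Proof.
case: k => [[|n]|n]; first exact: isom_refl.
  exact: (iter_shK n.+1).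
exact: (iter_unshK n.+1).
Qed.

Lemma cshift_iso (D : C -> Prop) k X Y :
  isomorphic X Y -> cshift D k X -> cshift D k Y.
Proof.
move=> XY [Z DZ XZ]; exists Z => //.
exact: isom_trans (isom_sym XY) XZ.
Qed.

Definition tri X Y Z := exists (f : Mor X Y) (g : Mor Y Z) h,
  dist (@Triangle C X Y Z f g h).

Lemma tri_iso X Y Z X' Y' Z' : isomorphic X X' -> isomorphic Y Y' ->
  isomorphic Z Z' -> tri X Y Z -> tri X' Y' Z'.
Proof.
move=> [a ia] [b ib] [c ic] [f [g [h d]]].
have [a' [a'a aa']] := ia; have [b' [b'b bb']] := ib.
have [c' [c'c cc']] := ic.
exists (b \oc f \oc a'), (c \oc g \oc b'), (fmap sh a \oc h \oc c').
apply: dist_iso d; exists a, b, c; split=> //; split=> /=.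
- by rewrite -compA a'a compm1.
- by rewrite -compA b'b compm1.
- by rewrite -compA c'c compm1.
Qed.

Lemma tri_sh X Y Z : tri X Y Z -> tri (sh X) (sh Y) (sh Z).
Proof.
move=> [f [g [h /dist_rot/dist_rot/dist_rot d]]].
by exists (- fmap sh f), (- fmap sh g), (- fmap sh h).
Qed.

Lemma tri_unsh X Y Z : tri X Y Z -> tri (unsh X) (unsh Y) (unsh Z).
Proof.
have i := fun X => isom_sym (isom_counit X).
move=> /(tri_iso (i X) (i Y) (i Z)) [f [g [h d]]].
have [f0 Ef] := sh_full f; have [g0 Eg] := sh_full g.
have [h0 Eh] := sh_full h.
exists (- f0), (- g0), (- h0); apply/dist_rot/dist_rot/dist_rot.
by rewrite /trot /= !fmapN !opprK -Ef -Eg -Eh.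
Qed.

Lemma tri_shz k X Y Z : tri X Y Z -> tri (shz k X) (shz k Y) (shz k Z).
Proof.
case: k => n t /=.
  by elim: n => // n IH; apply: tri_sh.
by elim: n => [|n IH]; apply: tri_unsh.
Qed.

Lemma dist_lift A (t : triangle C) (d : dist t) (u : Mor A (tY t)) :
  tg t \oc u = 0 -> exists s : Mor A (tX t), u = tf t \oc s.
Proof.
move=> gu0; have [[Z0 Z0P] _] := sc_additive C.
have /dist_rot d1 := dist_id A Z0P; move/dist_rot: d => d2.
have /= sq : (0 : Mor Z0 (tZ t)) \oc (0 : Mor A Z0) = tg t \oc u.
  by rewrite compm0 gu0.
have [c /= [_ E]] := dist_mor d1 d2 sq.
have [s Es] := sh_full c; exists s; apply: sh_inj; apply: oppr_inj.
by move: E; rewrite fmap1 compmN compm1 compNm Es -fmapM.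
Qed.

End ShiftFacts.

Section WeightFacts.
Variables (C : triangulated_cat) (w : weight_structure C).
Implicit Types (X Y Z : C) (k l : int).

Lemma w_leS k X : w_le w k X -> w_le w (k + 1) X.
Proof.
move=> [L LP XL]; have [L' L'P LL'] := w_shift LP; exists L' => //.
apply: (isom_trans XL); apply: (isom_trans (shz_iso k LL')).
exact: isom_trans (shz_sh k L') (shzS k L').
Qed.

Lemma w_le_mono k l X : k <= l -> w_le w k X -> w_le w l X.
Proof.
move=> kl; have -> : l = k + `|l - k|%N by rewrite gez0_abs ?subr_ge0 // subrKC.
elim: `|l - k|%N => [|n IH]; rewrite ?addr0 // => /IH.
by rewrite -addn1 PoszD addrA; apply: w_leS.
Qed.

Lemma w_le_sh k X : w_le w k X -> w_le w (k + 1) (sh X).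
Proof.
move=> [L LP XL]; exists L => //.
exact: isom_trans (fmap_iso sh XL) (shzS k L).
Qed.

Lemma wRO_iso X Y : isomorphic X Y -> wRO w X -> wRO w Y.
Proof.
have [ro _ _] := w_torsion w => XY /ro XP; apply/ro => L LP.
exact: (orth_iso (isom_refl L) XY (XP L LP)).
Qed.

Lemma w_geE l Y : w_ge w (l + 1) Y <-> cshift (wRO w) l Y.
Proof.
have key (R : C) : isomorphic (shz (l + 1) (unsh R)) (shz l R).
  apply: (isom_trans _ (shz_iso l (isom_counit R))).
  exact: isom_sym (isom_trans (shz_sh l (unsh R)) (shzS l (unsh R))).
split=> [[R' [R RP /= R'R] YR']|[R RP YR]].
  exists R => //; apply: (isom_trans YR').
  exact: isom_trans (shz_iso _ R'R) (key R).
exists (unsh R); last exact: isom_trans YR (isom_sym (key R)).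
by exists R => //; apply: isom_refl.
Qed.

Lemma w_orth k l X Y : k <= l -> w_le w k X -> w_ge w (l + 1) Y -> orth X Y.
Proof.
move=> kl /(w_le_mono kl)[L LP XL] /w_geE[R RP YR].
apply: (orth_iso (isom_sym XL) (isom_sym YR)); apply: orth_shz.
by have [/(_ R)[_ ro] _ _] := w_torsion w; apply: (ro RP L).
Qed.

Lemma wdecomp_exists k X : inhabited (wdecomp w k X).
Proof.
have [_ _ /(_ (shz (- k) X))[L [R [a [b [c [d LP RP]]]]]]] := w_torsion w.
have t : tri L (shz (- k) X) R by exists a, b, c.
have [f [g [h d']]] :=
  tri_iso (isom_refl _) (shzK k X) (isom_refl _) (tri_shz k t).
apply: inhabits; apply: (WDecomp d').
  by exists L => //; apply: isom_refl.
by apply/w_geE; exists R => //; apply: isom_refl.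
Qed.

Lemma wchoice_exists : inhabited (wchoice w).
Proof.
have W k X : exists _ : wdecomp w k X, True.
  by have [D] := wdecomp_exists k X; exists D.
by apply: inhabits => k X; case: (cid (W k X)).
Qed.

Lemma wext_exists k l X Y (D : wdecomp w k X) (E : wdecomp w l Y)
  (g : Mor X Y) : k <= l -> exists a, wext (D := D) (E := E) g a.
Proof.
move=> kl; have [|a Ea] := dist_lift (wd_dist E) (u := g \oc wleM D).
  exact: (w_orth kl (wleP D) (wgeP E)).
by exists a.
Qed.

Lemma wext_unique k l X Y (D : wdecomp w k X) (E : wdecomp w l Y)
  (g : Mor X Y) a a' : k < l ->
  wext (D := D) (E := E) g a -> wext (D := D) (E := E) g a' -> a = a'.
Proof.
move=> kl; rewrite /wext => Ea Ea'; apply: subr0_eq.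
set u := _ - _; have Eu : wleM E \oc u = 0 by rewrite compmB Ea Ea' subrr.
apply: sh_inj; rewrite fmap0.
have /dist_rot/dist_rot d := wd_dist E.
have [|s ->] := dist_lift d (u := fmap sh u).
  by rewrite /= compNm -fmapM Eu fmap0 oppr0.
rewrite (w_orth (k := k + 1) (l := l) _ (w_le_sh (wleP D)) (wgeP E) s) /=.
  by rewrite compm0.
by rewrite lezD1.
Qed.

End WeightFacts.

Section ImageFacts.
Variable A : abelian_cat.
Implicit Types X Y Z : A.

Lemma imM_mono X Y (f : Mor X Y) : mono (imM f).
Proof.
have [k0 kU] := kerP (cokerM f) => W a b E.
have [|s [_ sU]] := kU _ (imM f \oc a).
  by rewrite compA k0 comp0m.
by rewrite -(sU a) // -(sU b).
Qed.

Lemma im_kill X Y Z (f : Mor X Y) (u : Mor Y Z) :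
  u \oc f = 0 -> u \oc imM f = 0.
Proof.
move=> uf; have [_ /(_ _ u uf)[s [<- _]]] := cokerP f.
have [k0 _] := kerP (cokerM f).
by rewrite -compA k0 compm0.
Qed.

Lemma im_lift X Y Z (f : Mor X Y) (j : Mor Z Y) :
  cokerM f \oc j = 0 -> exists s : Mor Z (imO f), imM f \oc s = j.
Proof. by move=> /(proj2 (kerP (cokerM f)))[s [E _]]; exists s. Qed.

End ImageFacts.

Section VirtualTruncation.
Variables (C : triangulated_cat) (w : weight_structure C) (d : wchoice w).
Variables (k : int) (A : abelian_cat) (H : contrafunctor C A).
Implicit Types X Y Z : C.

Let ltS : k < k + 1. Proof. by rewrite ltrDl. Qed.

Lemma wconn_exists X :
  exists a, wext (D := d k X) (E := d (k + 1) X) (idmor X) a.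
Proof. exact: wext_exists (ltW ltS). Qed.

Definition wconn X : Mor (wle (d k X)) (wle (d (k + 1) X)) :=
  sval (cid (wconn_exists X)).

Lemma wconnP X : wext (idmor X) (wconn X).
Proof. by rewrite /wconn; case: cid. Qed.

Definition vtrunc_obj X : A := imO (cmap H (wconn X)).
Definition vtrunc_inc X : Mor (vtrunc_obj X) (H (wle (d k X))) :=
  imM (cmap H (wconn X)).

Lemma wconn_wext X Y (g : Mor X Y) (a : Mor (wle (d k X)) (wle (d k Y))) :
  wext g a -> wext g (wconn Y \oc a).
Proof. by rewrite /wext => Ea; rewrite compA wconnP comp1m. Qed.

Lemma vtrunc_map_exists X Y (g : Mor X Y) :
  exists t : Mor (vtrunc_obj Y) (vtrunc_obj X),
  forall a : Mor (wle (d k X)) (wle (d k Y)), wext g a ->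
    vtrunc_inc X \oc t = cmap H a \oc vtrunc_inc Y.
Proof.
have [a Ea] := wext_exists (d k X) (d k Y) g (lexx k).
have [b Eb] := wext_exists (d (k + 1) X) (d (k + 1) Y) g (lexx (k + 1)).
have sq : wconn Y \oc a = b \oc wconn X.
  apply: (wext_unique ltS (wconn_wext Ea)).
  by rewrite /wext compA Eb -compA wconnP comp1m.
have [|t Et] := im_lift (f := cmap H (wconn X)) (j := cmap H a \oc vtrunc_inc Y).
  rewrite compA; apply: im_kill.
  by rewrite -compA -cmapM sq cmapM compA (proj1 (cokerP _)) comp0m.
exists t => a' Ea'; rewrite /vtrunc_inc Et; apply: subr0_eq; rewrite -compBm.
apply: im_kill; rewrite compBm -!cmapM.
by rewrite (wext_unique ltS (wconn_wext Ea) (wconn_wext Ea')) subrr.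
Qed.

Definition vtrunc_map X Y (g : Mor X Y) : Mor (vtrunc_obj Y) (vtrunc_obj X) :=
  sval (cid (vtrunc_map_exists g)).

Lemma vtrunc_mapP X Y (g : Mor X Y) a : wext g a ->
  vtrunc_inc X \oc vtrunc_map g = cmap H a \oc vtrunc_inc Y.
Proof. by rewrite /vtrunc_map; case: cid => t /= tP /tP. Qed.

Lemma vtrunc_map1 X : vtrunc_map (idmor X) = idmor (vtrunc_obj X).
Proof.
apply: imM_mono; rewrite -/(vtrunc_inc X) (vtrunc_mapP (a := idmor _)).
  by rewrite cmap1 comp1m compm1.
by rewrite /wext compm1 comp1m.
Qed.

Lemma vtrunc_mapM X Y Z (g : Mor Y Z) (f : Mor X Y) :
  vtrunc_map (g \oc f) = vtrunc_map f \oc vtrunc_map g.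
Proof.
have [a Ea] := wext_exists (d k X) (d k Y) f (lexx k).
have [b Eb] := wext_exists (d k Y) (d k Z) g (lexx k).
apply: imM_mono; rewrite -/(vtrunc_inc X) compA (vtrunc_mapP Ea).
rewrite -compA (vtrunc_mapP Eb) compA -cmapM; apply: vtrunc_mapP.
by rewrite /wext compA Eb -compA Ea compA.
Qed.

(* [vtrunc] on objects is [Im (H(w_{<= k+1} X) -> H(w_{<= k} X))]; on [g] it is
   the map of images induced by any extension of [g] ([vtrunc_mapP]). *)
Definition vtrunc : contrafunctor C A :=
  @ContraFunctor C A vtrunc_obj vtrunc_map vtrunc_map1 vtrunc_mapM.

End VirtualTruncation.

Section AdditiveMaps.
Variables U V : zmodType.
Implicit Types f g h : {additive U -> V}.

HB.instance Definition _ := gen_eqMixin {additive U -> V}.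
HB.instance Definition _ := gen_choiceMixin {additive U -> V}.

Definition mkadd (f : U -> V) (fB : zmod_morphism f) : {additive U -> V} :=
  HB.pack f (GRing.isZmodMorphism.Build U V f fB).

Lemma additiveP f g : f =1 g -> f = g.
Proof.
move=> /funext; case: f g => [f [[fP]]] [g [[gP]]] /= E.
by subst g; rewrite (Prop_irrelevance fP gP).
Qed.

Definition add0 : {additive U -> V} := \0.
Definition addD f g : {additive U -> V} := f \+ g.
Definition addN f : {additive U -> V} := \- f.

Fact addDA : associative addD.
Proof. by move=> f g h; apply: additiveP => x /=; rewrite addrA. Qed.
Fact addDC : commutative addD.
Proof. by move=> f g; apply: additiveP => x /=; rewrite addrC. Qed.
Fact add0D : left_id add0 addD.
Proof. by move=> f; apply: additiveP => x /=; rewrite add0r. Qed.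
Fact addND : left_inverse add0 addN addD.
Proof. by move=> f; apply: additiveP => x /=; rewrite addNr. Qed.

HB.instance Definition _ :=
  GRing.isZmodule.Build {additive U -> V} addDA addDC add0D addND.

End AdditiveMaps.

Definition Ab_preadditive : preadditive.
Proof.
refine (@Preadditive zmodType (fun U V => {additive U -> V} : zmodType)
  (fun U => idfun) (fun U V W g f => g \o f) _ _ _ _ _).
- by move=> *; apply: additiveP.
- by move=> *; apply: additiveP.
- by move=> *; apply: additiveP.
- by move=> *; apply: additiveP.
- by move=> U V W g f f'; apply: additiveP => x /=; rewrite raddfD.
Defined.

Section AbKernel.
Variables (U V : zmodType) (f : {additive U -> V}).

Definition kerb : pred U := fun x => f x == 0.
Fact kerb_zmod_closed : zmod_closed kerb.
Proof.
split=> [|x y]; rewrite !unfold_in /kerb ?raddf0 //.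
by move=> /eqP fx /eqP fy; rewrite raddfB fx fy subrr.
Qed.
HB.instance Definition _ := GRing.isZmodClosed.Build U kerb kerb_zmod_closed.

Record ker_type := KerType { ker_val : U; _ : kerb ker_val }.
HB.instance Definition _ := [isSub for ker_val].
HB.instance Definition _ := [Choice of ker_type by <:].
HB.instance Definition _ := [SubChoice_isSubZmodule of ker_type by <:].

Definition ker_inc : {additive ker_type -> U} := val.

Definition rangeb : pred V := fun y => `[< exists x, f x = y >].
Fact rangeb_zmod_closed : zmod_closed rangeb.
Proof.
split=> [|x y]; rewrite !unfold_in /rangeb.
  by apply/asboolP; exists 0; rewrite raddf0.
move=> /asboolP[a <-] /asboolP[b <-]; apply/asboolP.
by exists (a - b); rewrite raddfB.
Qed.
HB.instance Definition _ :=
  GRing.isZmodClosed.Build V rangeb rangeb_zmod_closed.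

Definition coker_type :=
  Quotient.quot (GRing.ZmodClosed.clone V rangeb _).
HB.instance Definition _ := GRing.Zmodule.on coker_type.

Definition coker_proj : {additive V -> coker_type} :=
  (\pi_coker_type)%qT.

Lemma coker_projE x : coker_proj x = 0 <-> exists y, f y = x.
Proof.
split.
  rewrite -(raddf0 coker_proj) => /eqP.
  by rewrite /coker_proj /= -Quotient.idealrBE subr0 => /asboolP.
move=> fx; apply/eqP; rewrite -(raddf0 coker_proj).
by rewrite /coker_proj /= -Quotient.idealrBE subr0; apply/asboolP.
Qed.

Lemma coker_surj (q : coker_type) : exists x, coker_proj x = q.
Proof. by exists (repr q); rewrite /coker_proj /= reprK. Qed.

End AbKernel.

Section AbFactor.
Variables (U V W : zmodType).

(* Factorization through an injective, resp. surjective, additive map. *)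
Lemma factor_inj (i : {additive U -> V}) (j : {additive W -> V}) :
  injective i -> (forall w, exists u, i u = j w) ->
  exists s : {additive W -> U}, forall w, i (s w) = j w.
Proof.
move=> inj /choice[s sP].
have sB : zmod_morphism s by move=> x y; apply: inj; rewrite raddfB !sP raddfB.
by exists (mkadd sB).
Qed.

Lemma factor_surj (p : {additive U -> V}) (q : {additive U -> W}) :
  (forall v, exists u, p u = v) -> (forall u, p u = 0 -> q u = 0) ->
  exists s : {additive V -> W}, forall u, s (p u) = q u.
Proof.
move=> /choice[r rP] pq; pose s v := q (r v).
have sp u : s (p u) = q u.
  apply/eqP; rewrite /s -subr_eq0 -raddfB; apply/eqP/pq.
  by rewrite raddfB rP subrr.
have sB : zmod_morphism s.
  by move=> x y; rewrite -(rP x) -(rP y) -raddfB !sp raddfB.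
by exists (mkadd sB).
Qed.

End AbFactor.

Section AbAbelian.
Notation Ab := Ab_preadditive.
Implicit Types U V W : Ab.

Lemma Ab_is_kernel U V W (f : @Mor Ab U V) (i : @Mor Ab W U) :
  injective (i : {additive _ -> _}) ->
  (forall u, (f : {additive _ -> _}) u = 0 <->
     exists w, (i : {additive _ -> _}) w = u) ->
  is_kernel f i.
Proof.
move=> inj fi; split.
  by apply: additiveP => w /=; apply/fi; exists w.
move=> W' j fj0.
have [|s sP] := factor_inj (i := i : {additive _ -> _})
    (j := j : {additive _ -> _}) inj.
  by move=> w; apply/fi; have /(congr1 (fun h : {additive _ -> _} => h w)) := fj0.
exists s; split; first exact: additiveP.
move=> s' Es'; apply: additiveP => w; apply: inj; rewrite sP.
by rewrite -Es'.
Qed.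

Lemma Ab_is_cokernel U V W (f : @Mor Ab U V) (p : @Mor Ab V W) :
  (forall w, exists v, (p : {additive _ -> _}) v = w) ->
  (forall v, (p : {additive _ -> _}) v = 0 <->
     exists u, (f : {additive _ -> _}) u = v) ->
  is_cokernel f p.
Proof.
move=> surj pf; split.
  by apply: additiveP => u /=; apply/pf; exists u.
move=> W' q qf0.
have [|s sP] := factor_surj (p := p : {additive _ -> _})
    (q := q : {additive _ -> _}) surj.
  move=> v /pf[u <-].
  by have /(congr1 (fun h : {additive _ -> _} => h u)) := qf0.
exists s; split; first exact: additiveP.
move=> s' Es'; apply: additiveP => w; have [v <-] := surj w; rewrite sP.
by rewrite -Es'.
Qed.

Lemma Ab_mono_inj U V (f : @Mor Ab U V) :
  mono f -> injective (f : {additive _ -> _}).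
Proof.
move=> fm; apply: raddf_inj => x fx0.
have kx : kerb f x by apply/eqP.
have E : (ker_inc f : @Mor Ab (ker_type f) U) = 0.
  by apply: fm; apply: additiveP => -[y /eqP yP] /=; rewrite yP raddf0.
by have /(congr1 (fun h : {additive _ -> _} => h (KerType kx))) := E.
Qed.

Lemma Ab_epi_surj U V (f : @Mor Ab U V) :
  epi f -> forall v, exists u, (f : {additive _ -> _}) u = v.
Proof.
move=> fe v; apply/coker_projE.
have E : (coker_proj f : @Mor Ab V (coker_type f)) = 0.
  by apply: fe; apply: additiveP => u /=; apply/coker_projE; exists u.
by rewrite E.
Qed.

Lemma Ab_kerP U V (f : @Mor Ab U V) :
  is_kernel f (ker_inc f : @Mor Ab (ker_type f) U).
Proof.
apply: Ab_is_kernel => [|u]; first exact: val_inj.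
split=> [fu|[[x /eqP xP] <-] //].
by have kx : kerb f u by [apply/eqP]; exists (KerType kx).
Qed.

Lemma Ab_cokerP U V (f : @Mor Ab U V) :
  is_cokernel f (coker_proj f : @Mor Ab V (coker_type f)).
Proof. exact: Ab_is_cokernel (@coker_surj _ _ _) (@coker_projE _ _ _). Qed.

Lemma Ab_mono_normal U V (f : @Mor Ab U V) : mono f ->
  exists (W : Ab) (g : @Mor Ab V W), is_kernel g f.
Proof.
move=> /Ab_mono_inj inj; exists (coker_type f : zmodType), (coker_proj f).
exact: Ab_is_kernel inj (@coker_projE _ _ _).
Qed.

Lemma Ab_epi_normal U V (f : @Mor Ab U V) : epi f ->
  exists (W : Ab) (g : @Mor Ab W U), is_cokernel g f.
Proof.
move=> /Ab_epi_surj surj; exists (ker_type f : zmodType), (ker_inc f).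
apply: Ab_is_cokernel => // u; split=> [fu|[[x /eqP xP] <-] //].
by have kx : kerb f u by [apply/eqP]; exists (KerType kx).
Qed.

Fact Ab_inl_subproof U V : zmod_morphism (fun u : U => (u, 0) : U * V).
Proof. by move=> x y; congr (_, _); rewrite subrr. Qed.
Fact Ab_inr_subproof U V : zmod_morphism (fun v : V => (0, v) : U * V).
Proof. by move=> x y; congr (_, _); rewrite subrr. Qed.

Lemma Ab_is_additive : is_additive Ab.
Proof.
split.
  exists ('I_1 : zmodType); split=> X f; apply: additiveP => x.
    by rewrite [f x]ord1 [RHS]ord1.
  by rewrite [x]ord1 !raddf0.
move=> U V; exists (U * V : zmodType)%type.
exists (mkadd (@Ab_inl_subproof U V)), (mkadd (@Ab_inr_subproof U V)).
exists (@fst U V : {additive _ -> _}), (@snd U V : {additive _ -> _}).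
split; apply: additiveP => //= -[u v].
by congr (_, _); rewrite /= ?addr0 ?add0r.
Qed.

End AbAbelian.

Definition Ab : abelian_cat :=
  AbelianCat Ab_is_additive Ab_kerP Ab_cokerP Ab_mono_normal Ab_epi_normal.

Section Representable.
Variables (C : preadditive) (I : C).

Fact precomp_subproof (X Y : C) (g : Mor X Y) :
  zmod_morphism (fun f : Mor Y I => f \oc g).
Proof. by move=> f f'; apply: compBm. Qed.

Definition precomp (X Y : C) (g : Mor X Y) :
  @Mor Ab (Mor Y I) (Mor X I) := mkadd (precomp_subproof g).

Fact precomp1 (X : C) : precomp (idmor X) = idmor (Mor X I : Ab).
Proof. by apply: additiveP => f; apply: compm1. Qed.

Fact precompM (X Y Z : C) (g : Mor Y Z) (f : Mor X Y) :
  precomp (g \oc f) = precomp f \oc precomp g.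
Proof. by apply: additiveP => h; apply: compA. Qed.

Definition representable : contrafunctor C Ab :=
  @ContraFunctor C Ab (fun X => Mor X I) precomp precomp1 precompM.

End Representable.

(* Main.v *)
Require Import Defs.
From mathcomp Require Import all_boot all_order all_algebra.
(* Gives [compA] back its meaning in preadditive categories, which the
   composition of functions shadows. *)
Import Defs.

Set Implicit Arguments.
Unset Strict Implicit.
Unset Printing Implicit Defensive.

Import Order.TTheory GRing.Theory Num.Theory.
Local Open Scope ring_scope.

(** Write [L_k X -> X -> R_k X] for a [k]-weight decomposition, so that [L_k X]
    has weights at most [k] and [R_k X] has weights at least [k + 1].

    If [g : M -> N] kills weights [m], ..., [n], the composite
    [L_n M -> M -> N -> R_(m-1) N] vanishes, so [M -> N -> R_(m-1) N] factors
    through [M -> R_n M].  Any contravariant functor turns this factorization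
    into the inclusion between weight filtrations ([kills_weights_wfilt]).
    Conversely, for [H = Hom(-, R_(m-1) N)] the inclusion, tested on the element
    [N -> R_(m-1) N] of the filtration of [H(N)], is exactly that factorization
    ([wfilt_kills_weights]).

    The killing condition also says that [L_n M -> M -> N] factors through
    [L_(m-1) N].  If [H] is cohomological of weight range [m, n], it vanishes on
    [L_(m-1) N], and [H(M) -> H(L_n M)] is a monomorphism since [H(R_n M) = 0];
    therefore [H(g) = 0] ([kills_weights_range]).

    To come back from vanishing on cohomological functors one needs enough of
    them: for [I] of weights at least [m], the virtual truncation [T] at [n] of
    [Hom(-, I)] is cohomological ([vtrunc_cohomological]) and has weight range
    [m, n] ([vtrunc_weight_range]).  Here [T(X)] is the group of those morphisms
    [L_n X -> I] that extend along [L_n X -> L_(n+1) X].  For [I = R_(m-1) N]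
    the composite [L_n N -> N -> I] is such an element, and [T(g)] maps it to
    the composite [L_n M -> M -> N -> I] whose vanishing is the killing
    condition ([vtrunc_kills_weights]).

    The substance is the exactness of [T] on a triangle [X -> Y -> Z].  An
    element of [T(Y)], extended to [q : L_(n+1) Y -> I], dies in [T(X)] exactly
    when [q] vanishes on [L_n X], that is, when [q] extends to the cone [K] of
    [L_n X -> L_(n+1) Y].  This mixture of two indices is chosen because [K]
    behaves over [Z] like [L_(n+1) Z]: the cone of [K -> Z] should be an
    extension of [R_n X [1]] by [R_(n+1) Y], both of weights at least [n + 2].
    Only the resulting lifting properties of [K -> Z] matter, and they follow
    from two diagram chases of four lemma type ([cone_lift_exists] and
    [cone_lift_unique]).  The map [L_(n+1) Z -> K] so
    obtained carries the extension of [q] to an element of [T(Z)]. *)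

(** * Distinguished triangles *)

Section Triangles.
Variable C : triangulated_cat.
Implicit Types (X Y Z P I L R : C) (t : triangle C).

Lemma dist_comp0 t : dist t -> tg t \oc tf t = 0.
Proof.
move=> td; have [[O zO] _] := sc_additive C.
have [|c /= [<- _]] :=
  dist_mor (dist_id (tX t) zO) td (a := idmor _) (b := tf t).
  by [].
by rewrite compm0.
Qed.

Lemma dist_comp0' t : dist t -> th t \oc tg t = 0.
Proof. by move=> /dist_rot/dist_comp0. Qed.

Lemma is_zero_sh X : is_zero X -> is_zero (sh X).
Proof.
move=> [zX _]; have id0 : idmor (sh X) = 0.
  by rewrite -fmap1 (zX _ (idmor X)) fmap0.
by split=> Y f; [rewrite -[f]comp1m id0 comp0m | rewrite -[f]compm1 id0 compm0].
Qed.

(** Weak cokernel property, dual to [dist_lift]: compare the triangle with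
    [0 -> I -> I -> 0[1]]. *)
Lemma dist_colift t (td : dist t) I (u : Mor (tY t) I) :
  u \oc tf t = 0 -> exists s : Mor (tZ t) I, s \oc tg t = u.
Proof.
move=> uf0; have [[O zO] _] := sc_additive C.
have d0 : dist (Triangle (0 : Mor O I) (idmor I) (0 : Mor I (sh O))).
  apply/dist_rot; rewrite /trot /= fmap0 oppr0.
  exact: dist_id (is_zero_sh zO).
have [|c /= [E _]] := dist_mor td d0 (a := 0) (b := u).
  by rewrite /= uf0 compm0.
by exists c; rewrite E comp1m.
Qed.

(** [sh_triangle] identifies [trot (tunrot t)] with [t]. *)
Lemma dist_unrot t : dist t -> dist (tunrot t).
Proof.
move=> td; apply/dist_rot; apply: dist_iso td.
have [eK eVK] := sh_counitP (tZ t).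
exists (idmor _), (idmor _), (sh_counitV (tZ t)); split.
  split; [exact: is_iso_id | exact: is_iso_id |].
  by exists (sh_counit (tZ t)); split.
split=> /=; rewrite ?comp1m ?compm1 //.
rewrite fmap1 comp1m fmapN opprK fmapM.
rewrite -[LHS]compm1 -eVK compA sh_counit_nat.
have -> : sh_counit (sh (tX t)) = fmap sh (sh_unitV (tX t)).
  have [_ uVK] := sh_unitP (tX t).
  by rewrite -[LHS]compm1 -fmap1 -uVK fmapM compA sh_triangle comp1m.
by [].
Qed.

(** Exactness of [Hom(P, -)] along a triangle [L -> X -> R], in the form used
    for weight decompositions: orthogonality to [R] or its shift controls
    surjectivity and injectivity of [Hom(P, L) -> Hom(P, X)] and its shift. *)
Section Lifts.
Variables (L X R : C) (a : Mor L X) (b : Mor X R) (c : Mor R (sh L)).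
Hypothesis abc : dist (Triangle a b c).

Lemma lift_exists P (u : Mor P X) : orth P R -> exists s, u = a \oc s.
Proof. by move=> PR; apply: (dist_lift abc (u := u)); apply: PR. Qed.

Lemma lift_sh_unique P (u : Mor P (sh L)) :
  orth P R -> fmap sh a \oc u = 0 -> u = 0.
Proof.
move=> PR au0; have /dist_rot/dist_rot abc2 := abc.
have [|s ->] := dist_lift abc2 (u := u); first by rewrite /= compNm au0 oppr0.
by rewrite (PR s) compm0.
Qed.

Lemma lift_unique P (u : Mor P L) : orth (sh P) R -> a \oc u = 0 -> u = 0.
Proof.
move=> PR au0; apply: sh_inj; rewrite fmap0.
by apply: lift_sh_unique => //; rewrite -fmapM au0 fmap0.
Qed.

Lemma lift_sh_exists P (u : Mor P (sh X)) :
  orth P (sh R) -> exists s, u = fmap sh a \oc s.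
Proof.
move=> PR; have /dist_rot/dist_rot/dist_rot abc3 := abc.
have [|s ->] := dist_lift abc3 (u := u); first exact: PR.
by exists (- s); rewrite /= compNm compmN.
Qed.

End Lifts.

(** Morphisms [x] and [y] into the first two objects of a triangle, and a
    morphism [c] induced by them on cones:
<<
      LX --al--> LY --be--> K --ga--> LX[1]
      |x         |y         |c        |x[1]
      X ---f---> Y ---g---> Z ---h--> X[1]
>>
    The lifting properties of [c] are read off those of [x] and [y]. *)
Section Cone.
Variables (X Y Z : C) (f : Mor X Y) (g : Mor Y Z) (h : Mor Z (sh X)).
Variables (LX RX : C) (x : Mor LX X) (x' : Mor X RX) (x'' : Mor RX (sh LX)).
Variables (LY RY : C) (y : Mor LY Y) (y' : Mor Y RY) (y'' : Mor RY (sh LY)).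
Variables (K : C) (al : Mor LX LY) (be : Mor LY K) (ga : Mor K (sh LX)).
Variable c : Mor K Z.
Hypothesis dZ : dist (Triangle f g h).
Hypothesis dX : dist (Triangle x x' x'').
Hypothesis dY : dist (Triangle y y' y'').
Hypothesis dK : dist (Triangle al be ga).
Hypothesis fx : f \oc x = y \oc al.
Hypothesis cb : c \oc be = g \oc y.
Hypothesis hc : fmap sh x \oc ga = h \oc c.

(** Four lemma for [Hom(P, -)]: surjective at [y] and [x[1]], injective at
    [y[1]]. *)
Lemma cone_lift_exists P (u : Mor P Z) :
  orth P RY -> orth P (sh RX) -> exists s, u = c \oc s.
Proof.
move=> PRY PRX; have [v Ev] := lift_sh_exists dX (h \oc u) PRX.
have /dist_rot dZ1 := dZ; have /dist_rot/dist_rot dK2 := dK.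
have /= /eqP := dist_comp0' dZ1; rewrite compNm oppr_eq0 => /eqP hf.
have [|s Es] := dist_lift dK2 (u := v).
  apply/eqP; rewrite /= compNm oppr_eq0; apply/eqP.
  apply: (lift_sh_unique dY PRY).
  by rewrite compA -fmapM -fx fmapM -compA -Ev compA hf comp0m.
have [|t Et] := dist_lift dZ1 (u := u - c \oc s).
  by rewrite /= compmB compA -hc Ev Es -!compA subrr.
have [t' Et'] := lift_exists dY t PRY.
exists (s + be \oc t').
by rewrite compDr compA cb -compA -Et' -[g \oc t]Et addrC subrK.
Qed.

(** Four lemma for [Hom(P, -)]: injective at [y] and [x[1]], surjective at
    [x]. *)
Lemma cone_lift_unique P (s : Mor P K) :
  orth P RX -> orth (sh P) RY -> c \oc s = 0 -> s = 0.
Proof.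
move=> PRX PRY cs0; have /dist_rot dK1 := dK.
have [|t Et] := dist_lift dK1 (u := s).
  by apply: (lift_sh_unique dX PRX); rewrite /= compA hc -compA cs0 compm0.
have [|r Er] := dist_lift dZ (u := y \oc t).
  by rewrite /= compA -cb -compA -[be \oc t]Et cs0.
have [r' Er'] := lift_exists dX r PRX.
have -> : s = be \oc (al \oc r').
  rewrite Et /=; congr (_ \oc _); apply: subr0_eq; apply: (lift_unique dY PRY).
  by rewrite compmB Er /= Er' !compA fx subrr.
by rewrite compA (dist_comp0 dK) comp0m.
Qed.

End Cone.

End Triangles.

(** * Morphisms that kill weights *)

Section Kill.
Variables (C : triangulated_cat) (w : weight_structure C).
Implicit Types (X Y M N : C) (k l m n : int).

Lemma w_ge_sh k X : w_ge w k X -> w_ge w (k + 1) (sh X).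
Proof.
move=> [L LP XL]; exists L => //.
exact: isom_trans (fmap_iso sh XL) (shzS k L).
Qed.

(** Morphisms of weight decompositions extending the identities of [M] and [N]
    transport the vanishing from the given decompositions to any others; they
    may also move the indices inwards. *)
Lemma kills_weights_any m n k l M N (g : Mor M N) (D : wdecomp w k M)
  (E : wdecomp w l N) :
  k <= n -> m - 1 <= l -> kills_weights w m n g ->
  wgeM E \oc g \oc wleM D = 0.
Proof.
move=> kn ml [D' [E' g0]].
have [a Ea] := wext_exists D D' (idmor M) kn.
have [e Ee] := wext_exists E' E (idmor N) ml.
have [|h /= Eh] := dist_lift (wd_dist E') (u := g \oc wleM D').
  by rewrite /= compA.
rewrite -compA -[wleM D]comp1m -Ea (compA g) Eh -(comp1m (wleM E')) -Ee !compA.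
by rewrite (dist_comp0 (wd_dist E)) !comp0m.
Qed.

(** [wgeM \oc g] kills [L_n M], so it extends to [R_n M]; applying [H] to the
    resulting square gives the inclusion of images. *)
Lemma kills_weights_wfilt (d : wchoice w) m n M N (g : Mor M N)
  (A : abelian_cat) (H : contrafunctor C A) :
  kills_weights w m n g ->
  sends_inside (cmap H g) (wfiltM d H m N) (wfiltM d H (n + 1) M).
Proof.
move=> gP; have n1 : n + 1 - 1 <= n by rewrite addrK.
have /(dist_colift (wd_dist (d (n + 1 - 1) M)))[t Et] :=
  kills_weights_any (d (n + 1 - 1) M) (d (m - 1) N) n1 (lexx _) gP.
suff /im_lift[s Es] : cokerM (cmap H (wgeM (d (n + 1 - 1) M)))
    \oc (cmap H g \oc wfiltM d H m N) = 0 by exists s; rewrite -Es.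
rewrite compA; apply: im_kill; rewrite -compA -cmapM -Et cmapM compA.
by rewrite (proj1 (cokerP _)) comp0m.
Qed.

(** [H(g)] followed by the monomorphism [H(M) -> H(L_n M)] factors through
    [H(L_(m-1) N) = 0]. *)
Lemma kills_weights_range m n M N (g : Mor M N)
  (A : abelian_cat) (H : contrafunctor C A) :
  cohomological H -> weight_range w H m n -> kills_weights w m n g ->
  cmap H g = 0.
Proof.
move=> Hc [Hm Hn] [D [E g0]].
have [|h /= Eh] := dist_lift (wd_dist E) (u := g \oc wleM D).
  by rewrite /= compA.
have [_ /(_ _ (cmap H g))[|s [<- _]]] :=
  Hc _ (wd_dist D) 0%N _ (or_introl erefl).
  rewrite /= -cmapM Eh cmapM.
  by rewrite (proj1 (Hm _ (wleP E)) _ (cmap H (wleM E))) compm0.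
have -> : imM (cmap H (wgeM D)) = 0.
  rewrite -[imM _]comp1m; apply: im_kill.
  by rewrite (proj2 (Hn _ (wgeP D)) _ (cmap H (wgeM D))) compm0.
by rewrite comp0m.
Qed.

End Kill.

(** * Images and exactness in abelian groups *)

Section AbImage.
Notation Ab := Ab_preadditive.

Definition app (U V : Ab) (f : @Mor Ab U V) : U -> V := (f : {additive U -> V}).

Lemma app_ext (U V : Ab) (f g : @Mor Ab U V) : app f =1 app g -> f = g.
Proof. exact: additiveP. Qed.

Lemma Ab_imP (U V : Defs.Ab) (f : Mor U V) v :
  (exists s, app (imM f) s = v) <-> exists u, app f u = v.
Proof.
split=> [[s <-]|/(coker_projE f)/eqP fv].
  apply/(coker_projE f); case: s => s /= sP; exact/eqP.
by exists (KerType fv).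
Qed.

Lemma Ab_imM_inj (U V : Defs.Ab) (f : Mor U V) : injective (app (imM f)).
Proof. exact: Ab_mono_inj (@imM_mono _ _ _ f). Qed.

Lemma Ab_exact (U V W : Defs.Ab) (f : Mor U V) (g : Mor V W) :
  (forall v, app g v = 0 <-> exists u, app f u = v) -> exact_at f g.
Proof.
move=> fg; apply: Ab_is_kernel; first exact: Ab_imM_inj.
by move=> v; apply: (iff_trans (fg v)); apply: iff_sym; apply: Ab_imP.
Qed.

Lemma Ab_is_zero (U : Ab) : (forall u : U, u = 0) -> is_zero U.
Proof.
move=> U0; split=> V f; apply: app_ext => u; first by rewrite [LHS]U0 [RHS]U0.
by rewrite (U0 u) /app !raddf0.
Qed.

End AbImage.

(** * The virtual truncation of a representable functor *)

Section Truncation.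
Variables (C : triangulated_cat) (w : weight_structure C) (d : wchoice w).
Variables (n : int) (I : C).
Implicit Types (X Y Z M N : C).

Let T := vtrunc d n (representable I).
(* Through [inc], elements of [T X] are treated as morphisms [L_n X -> I]. *)
Let inc X : T X -> Mor (wle (d n X)) I :=
  @app _ _ (vtrunc_inc d n (representable I) X).

Lemma vtrunc_incP X (p : Mor (wle (d n X)) I) :
  (exists v, inc v = p) <-> exists q, p = q \oc wconn d n X.
Proof.
apply: (iff_trans (Ab_imP _ _)).
by split=> -[q]; [move<-|move->]; exists q.
Qed.

Lemma vtrunc_inc_factor X (v : T X) : exists q, inc v = q \oc wconn d n X.
Proof. by apply/vtrunc_incP; exists v. Qed.

Lemma vtrunc_inc_inj X : injective (@inc X).
Proof. exact: Ab_imM_inj. Qed.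

Lemma vtrunc_inc_map X Y (g : Mor X Y) a (v : T Y) :
  wext (D := d n X) (E := d n Y) g a ->
  inc (app (cmap T g) v) = inc v \oc a.
Proof.
move=> Ea; have := vtrunc_mapP (representable I) Ea.
by move=> /(congr1 (fun h => app h v)).
Qed.

(** The extension of [q] to the cone [K] of [L_n X -> L_(n+1) Y] is pulled back
    along a lift [s : L_(n+1) Z -> K] of [L_(n+1) Z -> Z].  The result restricts
    to the given element of [T(Y)] because [L_n Y] has only one lift to [K] over
    [Z]. *)
Lemma vtrunc_cohomological : cohomological T.
Proof.
move=> t0 td0 i r Er; have {t0 td0 i Er} rd : dist r.
  by case: Er => ->; elim: i => //= i; [move/dist_rot | move/dist_unrot].
case: r rd => X Y Z f g h rd; apply: Ab_exact.
change (forall v : T Y,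
  app (cmap T f) v = 0 <-> exists u : T Z, app (cmap T g) u = v) => v.
have n1 : n < n + 1 by rewrite ltrDl.
have [a Ea] := wext_exists (d n X) (d n Y) f (lexx n).
have [b Eb] := wext_exists (d n Y) (d n Z) g (lexx n).
have gf0 : g \oc f = 0 := dist_comp0 rd.
split=> [fv0|[u <-]]; last first.
  apply: vtrunc_inc_inj; rewrite (vtrunc_inc_map _ Ea) (vtrunc_inc_map _ Eb).
  (* [b \oc a] itself may be nonzero; it becomes unique, hence zero, only over
     [L_(n+1) Z]. *)
  have [q ->] := vtrunc_inc_factor u; rewrite -!compA.
  have -> : wconn d n Z \oc (b \oc a) = 0.
    apply: (wext_unique n1 (g := 0)); last by rewrite /wext comp0m compm0.
    by apply: wconn_wext; rewrite /wext compA Eb -compA Ea compA gf0.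
  by rewrite compm0 [RHS]raddf0.
have [q Eq] := vtrunc_inc_factor v.
pose al := wconn d n Y \oc a.
have [K [be [ga dK]]] := dist_ext al.
have fx : wleM (d (n + 1) Y) \oc al = f \oc wleM (d n X) := wconn_wext Ea.
have [c /= [cb hc]] := dist_mor dK rd fx.
have [|r /= Er] := dist_colift dK (u := q).
  by rewrite /= /al compA -Eq -(vtrunc_inc_map _ Ea) fv0 [LHS]raddf0.
have [||s Es] := cone_lift_exists rd (wd_dist (d n X)) (wd_dist (d (n + 1) Y))
  dK (esym fx) cb hc (wleM (d (n + 1) Z)).
- exact: w_orth (lexx _) (wleP _) (wgeP _).
- exact: w_orth (lexx _) (wleP _) (w_ge_sh (wgeP _)).
have [u Eu] := (vtrunc_incP _).2 (ex_intro _ (r \oc s) erefl).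
exists u; apply: vtrunc_inc_inj; rewrite (vtrunc_inc_map _ Eb) Eu Eq -Er.
rewrite -!compA.
congr (_ \oc _); apply: subr0_eq.
apply: (cone_lift_unique rd (wd_dist (d n X)) (wd_dist (d (n + 1) Y))
  dK (esym fx) cb hc).
- exact: w_orth (lexx _) (wleP _) (wgeP _).
- exact: w_orth (lexx _) (w_le_sh (wleP _)) (wgeP _).
rewrite compmB !compA -Es cb -compA (wconn_wext Eb) -compA wconnP.
by rewrite comp1m subrr.
Qed.

(** For [X] of weights at most [m - 1], [L_(n+1) X -> X] has a section, so
    elements of [T(X)] are composites [L_n X -> X -> I], and [Hom(X, I) = 0].
    For [X] of weights at least [n + 1], the zero morphism is a lift of
    [L_n X -> X] to [L_(n+1) X], hence the connecting one. *)
Lemma vtrunc_weight_range m : m <= n -> w_ge w m I -> weight_range w T m n.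
Proof.
move=> mn Im; have n1 : n < n + 1 by rewrite ltrDl.
split=> X XP; apply: Ab_is_zero => v; apply: vtrunc_inc_inj;
  rewrite [RHS]raddf0; have [q ->] := vtrunc_inc_factor v.
  have [|s Es] := lift_exists (wd_dist (d (n + 1) X)) (idmor X).
    apply: w_orth XP (wgeP _); apply: (@le_trans _ _ m).
      by rewrite gerBl.
    exact: le_trans mn (ltW n1).
  have -> : wconn d n X = s \oc wleM (d n X).
    by apply: (wext_unique n1 (wconnP _ _ _)); rewrite /wext compA -Es.
  rewrite compA (w_orth (lexx (m - 1)) XP _ (q \oc s)) ?comp0m //.
  by rewrite subrK.
have -> : wconn d n X = 0.
  apply: (wext_unique n1 (wconnP _ _ _)); rewrite /wext compm0 comp1m.
  exact: esym (w_orth (lexx n) (wleP _) XP _).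
by rewrite compm0.
Qed.

End Truncation.

(** * Recovering the killing condition *)

Section Converse.
Variables (C : triangulated_cat) (w : weight_structure C) (d : wchoice w).
Implicit Types (M N I : C) (m n : int).

(** Yoneda: follow the element [wgeM] of [H(N)], the image of the identity of
    [I]. *)
Lemma wfilt_kills_weights m n M N (g : Mor M N)
    (I := wge (d (m - 1) N)) (H := representable I) :
  sends_inside (cmap H g) (wfiltM d H m N) (wfiltM d H (n + 1) M) ->
  kills_weights w m n g.
Proof.
move=> [s Es].
have [i Ei] : exists i, app (wfiltM d H m N) i = wgeM (d (m - 1) N).
  by apply/Ab_imP; exists (idmor I); apply: comp1m.
have [u Eu] : exists u : Mor _ I,
    u \oc wgeM (d (n + 1 - 1) M) = wgeM (d (m - 1) N) \oc g.
  apply/(Ab_imP (cmap H (wgeM (d (n + 1 - 1) M)))); exists (app s i).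
  move/(congr1 (fun h => app h i)): Es => /esym Es; apply: (etrans Es).
  exact: (congr1 (fun f => f \oc g) Ei).
move: (d (n + 1 - 1) M) u Eu; rewrite addrK => D u Eu.
exists D, (d (m - 1) N).
by rewrite -Eu -compA (dist_comp0 (wd_dist D)) compm0.
Qed.

(** The element [wgeM E \oc wleM] belongs to [T(N)] because it extends to
    [L_(n+1) N], and [T(g)] sends it to [wgeM E \oc g \oc wleM]. *)
Lemma vtrunc_kills_weights m n M N (g : Mor M N) (E : wdecomp w (m - 1) N) :
  cmap (vtrunc d n (representable (wge E))) g = 0 -> kills_weights w m n g.
Proof.
move=> T0; exists (d n M), E.
have [a Ea] := wext_exists (d n M) (d n N) g (lexx n).
have [|v Ev] := (vtrunc_incP (wgeM E \oc wleM (d n N))).2.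
  by exists (wgeM E \oc wleM (d (n + 1) N)); rewrite -compA wconnP comp1m.
rewrite -compA -Ea compA -Ev -(vtrunc_inc_map _ Ea) T0.
exact: raddf0.
Qed.

End Converse.

Theorem theorem2p1p2 (C : triangulated_cat) (w : weight_structure C)
    (d : wchoice w) (m n : int) (hmn : m <= n) (M N : C) (g : Mor M N)
    (D0 : wdecomp w (m - 1) N) :
  [<->
    (* 1 *) kills_weights w m n g;
    (* 2 *) forall (A : abelian_cat) (H : contrafunctor C A),
      sends_inside (cmap H g) (wfiltM d H m N) (wfiltM d H (n + 1) M);
    (* 3 *) forall I : C, w_ge w m I ->
      sends_inside (cmap (representable I) g)
        (wfiltM d (representable I) m N) (wfiltM d (representable I) (n + 1) M);
    (* 4 *) forall (A : abelian_cat) (H : contrafunctor C A),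
      cohomological H -> weight_range w H m n -> cmap H g = 0;
    (* 5 *) forall I : C, w_ge w m I ->
      cmap (vtrunc d n (representable I)) g = 0;
    (* 6 *) cmap (vtrunc d n (representable (wge D0))) g = 0
  ].
Proof.
have wgeE (D : wdecomp w (m - 1) N) : w_ge w m (wge D).
  by have := wgeP D; rewrite subrK.
tfae.
- by move=> gK A H; apply: kills_weights_wfilt.
- by move=> gW I _; apply: gW.
- move=> gW A H Hc Hw; apply: (kills_weights_range Hc Hw).
  exact: wfilt_kills_weights (gW _ (wgeE _)).
- move=> gR I Im; apply: gR; first exact: vtrunc_cohomological.
  exact: vtrunc_weight_range.
- by move=> gT; apply: gT.
- exact: vtrunc_kills_weights.
Qed.
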